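(* Let $X$ and $Y$ be random variables with values in $\mathbb{R}^n$ and $\mathbb{R}^m$, with means $m_x=\mathbb{E}[X]$, $m_y=\mathbb{E}[Y]$ and covariances $\Sigma_x=\mathbb{E}[(X-m_x)(X-m_x)^T]$, $\Sigma_y=\mathbb{E}[(Y-m_y)(Y-m_y)^T]$, $\Sigma_{xy}=\mathbb{E}[(X-m_x)(Y-m_y)^T]$. Assume that $\Sigma_x$ is positive definite. Let $\Theta=S^n_+\times\mathbb{R}^{n\times m}\times\mathbb{R}^n$, where $S^n_+$ is the set of positive-definite $n\times n$ matrices. Then the optimization problem $$\min_{(A,K,\tilde b)\in\Theta}\ \tfrac12\mathrm{Tr}(A\Sigma_x)+\tfrac12\mathrm{Tr}(A^{-1}\Sigma_x)+\tfrac12\mathrm{Tr}(A^{-1}K\Sigma_yK^T)-\mathrm{Tr}(A^{-1}\Sigma_{xy}K^T)+\tfrac12(\tilde b-m_x)^TA^{-1}(\tilde b-m_x)$$ is convex and admits the unique solution $$\tilde b=m_x,\qquad K=\Sigma_{xy}\Sigma_y^{-1},\qquad A=\Sigma_x^{-1/2}\Big(\Sigma_x^{1/2}\big(\Sigma_x-\Sigma_{xy}\Sigma_y^{-1}\Sigma_{xy}^T\big)\Sigma_x^{1/2}\Big)^{1/2}\Sigma_x^{-1/2},$$ with resulting transport map $$\nabla_x\bar f(x,y)=m_x+A(x-m_x)+K(y-m_y),$$ where $\bar f(x,y)=\tfrac12x^TAx+x^T(Ky+b)$ with $b=\tilde b-Am_x-Km_y$ and these optimal $A,K,\tilde b$.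
   Context: $\mathrm{Tr}$ denotes the trace. The exponent $1/2$ on a symmetric positive semidefinite matrix denotes its symmetric positive semidefinite square root, and $\Sigma_x^{-1/2}=(\Sigma_x^{1/2})^{-1}$. Positive-definite matrices are understood to be symmetric. The optimization variables $(A,K,\tilde b)$ parametrize the quadratic functions $f(x,y)=\tfrac12x^TAx+x^T(Ky+b)$ on $\mathbb{R}^n\times\mathbb{R}^m$ through $b=\tilde b-Am_x-Km_y$.
   Formalization: The unique solution and transport map are stated under the added assumptions that Σ_y is invertible and Σ_x − Σ_xy Σ_y^{-1} Σ_xy^T is positive definite; without them Σ_y^{-1} is undefined or (e.g. X = Y) the displayed A is not positive definite. *)

(* Defs.v *)
From HB Require Import structures.
From mathcomp Require Import all_boot all_order all_algebra.
From mathcomp Require Import all_classical all_reals all_analysis.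

Set Implicit Arguments.
Unset Strict Implicit.
Unset Printing Implicit Defensive.

Import Order.TTheory GRing.Theory Num.Theory.
Import numFieldNormedType.Exports.

Local Open Scope classical_set_scope.
Local Open Scope ring_scope.

Definition posdefmx (R : realType) (n : nat) (A : 'M[R]_n) : Prop :=
  A^T = A /\ forall x : 'cV[R]_n, x != 0 -> 0 < (x^T *m A *m x) 0 0.

Definition possemidefmx (R : realType) (n : nat) (A : 'M[R]_n) : Prop :=
  A^T = A /\ forall x : 'cV[R]_n, 0 <= (x^T *m A *m x) 0 0.

(* The symmetric positive semidefinite square root. It exists and is unique
   whenever A is symmetric positive semidefinite; the value 0 is a junk value
   for the other matrices. *)
Definition sqrtmx (R : realType) (n : nat) (A : 'M[R]_n) : 'M[R]_n :=
  xget 0 [set B | possemidefmx B /\ B *m B = A].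

(* A random vector is square integrable when all its coordinates are measurable
   and have a finite second moment (Lfun contains measurability); its mean and
   covariances are then finite, so that fine below is harmless. *)
Definition square_integrable (R : realType) (d : measure_display)
    (T : measurableType d) (P : probability T R) (n : nat)
    (X : T -> 'cV[R]_n) : Prop :=
  forall i : 'I_n, (fun w => X w i ord0) \in Lfun P 2%:E.

Definition meanv (R : realType) (d : measure_display) (T : measurableType d)
    (P : probability T R) (n : nat) (X : T -> 'cV[R]_n) : 'cV[R]_n :=
  \col_i fine ('E_P[fun w => X w i ord0])%E.

(* covmx P X Y = E[(X - E[X]) (Y - E[Y])^T]. *)
Definition covmx (R : realType) (d : measure_display) (T : measurableType d)
    (P : probability T R) (n m : nat) (X : T -> 'cV[R]_n) (Y : T -> 'cV[R]_m) :
    'M[R]_(n, m) :=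
  \matrix_(i, j) fine (covariance P (fun w => X w i ord0) (fun w => Y w j ord0)).

Definition Theta (R : realType) (n m : nat) :
    set ('M[R]_n * 'M[R]_(n, m) * 'cV[R]_n) :=
  [set p | posdefmx p.1.1].

Definition objective (R : realType) (n m : nat) (mx : 'cV[R]_n)
    (Sx : 'M[R]_n) (Sy : 'M[R]_m) (Sxy : 'M[R]_(n, m))
    (p : 'M[R]_n * 'M[R]_(n, m) * 'cV[R]_n) : R :=
  let: (A, K, bt) := p in
  2^-1 * \tr (A *m Sx) + 2^-1 * \tr (invmx A *m Sx)
  + 2^-1 * \tr (invmx A *m K *m Sy *m K^T)
  - \tr (invmx A *m Sxy *m K^T)
  + 2^-1 * ((bt - mx)^T *m invmx A *m (bt - mx)) 0 0.

Definition argmin (R : realType) (E : Type) (D : set E) (f : E -> R) : set E :=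
  [set p | D p /\ forall q, D q -> f p <= f q].

Definition quadf (R : realType) (n m : nat) (A : 'M[R]_n) (K : 'M[R]_(n, m))
    (b : 'cV[R]_n) (x : 'cV[R]_n) (y : 'cV[R]_m) : R :=
  2^-1 * (x^T *m A *m x) 0 0 + (x^T *m (K *m y + b)) 0 0.

Definition gradient (R : realType) (n : nat) (f : 'cV[R]_n -> R)
    (x : 'cV[R]_n) : 'cV[R]_n :=
  \col_i 'D_(delta_mx i 0 : 'cV[R]_n) (f : 'cV[R]_n -> R^o) x.

(* Main.v *)
Require Import Defs.
From HB Require Import structures.
From mathcomp Require Import all_boot all_order all_algebra.
From mathcomp Require Import spectral complex.
From mathcomp Require Import ring lra.
From mathcomp Require Import all_classical all_reals all_analysis.

(* Writing Z for the covariance matrix of (X, Y), the objective is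
     1/2 (tr (A Sx) + tr (A^-1 L Z L^T) + tr (A^-1 v v^T)),
   with L = [I, -K] and v = bt - mx.  It is convex because
   w^T L^T A^-1 L w = max_u (2 u^T L w - u^T A u) is jointly convex in (A, L) and
   Z is positive semidefinite.
   With S the Schur complement of Sy in Z, K0 = Sxy Sy^-1 and A0 the solution of
   A0 Sx A0 = S, completing squares gives
     J(A, K, bt) = tr (A0 Sx) + 1/2 (tr (A^-1 (A - A0) Sx (A - A0)^T)
       + tr (A^-1 (K - K0) Sy (K - K0)^T) + tr (A^-1 v v^T)),
   whose last three terms are nonnegative and vanish only at (A0, K0, mx). *)

Set Implicit Arguments.
Unset Strict Implicit.
Unset Printing Implicit Defensive.

Import Order.TTheory GRing.Theory Num.Theory.
Import numFieldNormedType.Exports.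

Local Open Scope classical_set_scope.
Local Open Scope ring_scope.

(** * Gram matrices, traces of squares and eigenvalues *)

Section PositiveMatrices.
Variable R : realType.

Lemma mxtrace_mul_tr m n (M : 'M[R]_(m, n)) :
  \tr (M *m M^T) = \sum_i \sum_j M i j ^+ 2.
Proof.
rewrite /mxtrace; apply: eq_bigr => i _; rewrite mxE.
by apply: eq_bigr => j _; rewrite mxE expr2.
Qed.

Lemma mxtrace_mul_tr_ge0 m n (M : 'M[R]_(m, n)) : 0 <= \tr (M *m M^T).
Proof.
by rewrite mxtrace_mul_tr; do 2!apply: sumr_ge0 => ? _; exact: sqr_ge0.
Qed.

Lemma mxtrace_mul_tr_eq0 m n (M : 'M[R]_(m, n)) : \tr (M *m M^T) = 0 -> M = 0.
Proof.
rewrite mxtrace_mul_tr => M0; apply/matrixP => i j; rewrite mxE.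
have ge0 k : 0 <= \sum_j M k j ^+ 2.
  by apply: sumr_ge0 => l _; exact: sqr_ge0.
have /(_ i isT) Mi0 := psumr_eq0P (fun k _ => ge0 k) M0.
have /(_ j isT) /eqP := psumr_eq0P (fun k _ => sqr_ge0 (M i k)) Mi0.
by rewrite sqrf_eq0 => /eqP.
Qed.

(** Squared norm of [C *m x], in the shape [M *m M^T] that the trace lemmas expect. *)
Lemma gram_form n m (C : 'M[R]_(m, n)) (x : 'cV[R]_n) :
  (x^T *m (C^T *m C) *m x) 0 0 = \tr ((C *m x)^T *m (C *m x)^T^T).
Proof. by rewrite trace_mx11 trmxK trmx_mul !mulmxA. Qed.

Lemma possemidefmx_gram n m (C : 'M[R]_(m, n)) : possemidefmx (C^T *m C).
Proof.
split=> [|x]; first by rewrite trmx_mul trmxK.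
by rewrite gram_form mxtrace_mul_tr_ge0.
Qed.

Lemma posdefmx_possemidefmx n (A : 'M[R]_n) : posdefmx A -> possemidefmx A.
Proof.
move=> [Asym Apos]; split => // x; have [->|/Apos/ltW//] := eqVneq x 0.
by rewrite mulmx0 mxE.
Qed.

Lemma possemidefmx_conj n m (A : 'M[R]_n) (M : 'M[R]_(m, n)) :
  possemidefmx A -> possemidefmx (M *m A *m M^T).
Proof.
move=> [Asym Apos]; split=> [|x]; first by rewrite !trmx_mul trmxK Asym !mulmxA.
by have := Apos (M^T *m x); rewrite trmx_mul trmxK !mulmxA.
Qed.

Lemma possemidefmx_eigenvalue_ge0 n (A : 'M[R]_n) a :
  possemidefmx A -> eigenvalue A a -> 0 <= a.
Proof.
move=> [_ Apos] /eigenvalueP[v vA v0].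
have := Apos v^T; rewrite trmxK vA -scalemxAl mxE -trace_mx11 => h.
have v1 : 0 < \tr (v *m v^T).
  rewrite lt_def mxtrace_mul_tr_ge0 andbT.
  by apply: contraNneq v0 => /mxtrace_mul_tr_eq0 ->.
by rewrite -(pmulr_lge0 _ v1).
Qed.

(** * Existence of the positive semidefinite square root *)

Lemma poly_interpolation n (d : 'I_n -> R) (f : R -> R) :
  exists r : {poly R}, forall i, r.[d i] = f (d i).
Proof.
suff [r rP] : exists r : {poly R}, {in codom d, forall x, r.[x] = f x}.
  by exists r => i; rewrite rP// codom_f.
elim: (codom d) => [|a s [r rP]]; first by exists 0.
have [as_|ans] := boolP (a \in s).
  by exists r => x; rewrite inE => /predU1P[->|]; exact: rP.
(* Newton interpolation: [q] vanishes at the earlier nodes and not at the new node [a], so a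
   multiple of it corrects the value at [a] alone. *)
pose q := \prod_(c <- s) ('X - c%:P).
exists (r + ((f a - r.[a]) / q.[a]) *: q) => x.
rewrite inE hornerD hornerZ => /predU1P[->|xs].
  have qa : q.[a] != 0 by rewrite -/(root _ _) root_prod_XsubC.
  by rewrite divfK// addrC subrK.
have /rootP -> : root q x by rewrite root_prod_XsubC.
by rewrite mulr0 addr0 rP.
Qed.

Lemma horner_mx_diagonalizable (F : fieldType) n (Q : 'M[F]_n.+1) (d : 'rV[F]_n.+1)
    (p : {poly F}) :
  Q \in unitmx ->
  horner_mx (invmx Q *m diag_mx d *m Q) p
  = invmx Q *m diag_mx (map_mx (horner p) d) *m Q.
Proof. by move=> Qu; rewrite horner_mx_uconjC// horner_mx_diag. Qed.

(* The root is r(A)^2, where r interpolates the fourth root on the spectrum: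
   this makes it a real symmetric square, although the spectral theorem is
   applied over R[i]. *)
Lemma possemidefmx_sqrt_exists n (A : 'M[R]_n) : possemidefmx A ->
  exists B, possemidefmx B /\ B *m B = A.
Proof.
case: n A => [A _|n A psdA].
  by exists 0; split; [split=> [|x]; rewrite ?mulmx0 ?mul0mx ?trmx0 ?mxE|
    apply/matrixP => -[]].
have [Asym _] := psdA.
pose f : {rmorphism R -> R[i]} := @real_complex R.
have herm : map_mx f A \is hermsymmx.
  apply/is_hermitianmxP; rewrite expr0 scale1r; apply/matrixP => i j.
  rewrite !mxE -[in LHS]Asym mxE; apply/esym/CrealP.
  by apply/complex_realP; exists (A j i).
have /mxOverP dreal := hermitian_spectral_diag_real herm.
have /orthomx_spectralP := hermitian_normalmx herm.
have := spectral_unit (map_mx f A).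
set P := spectralmx _; set sp := spectral_diag _ => Punit AE.
pose d i := complex.Re (sp 0 i).
have fd i : f (d i) = sp 0 i by exact/RRe_real/dreal.
(* Row [i] of [P] is a left eigenvector over [R[i]], nonzero because [P] is invertible;
   [eigenvalue_map] brings the real eigenvalue [d i] back to [A]. *)
have d_ge0 i : 0 <= d i.
  apply: (possemidefmx_eigenvalue_ge0 psdA).
  rewrite -(eigenvalue_map f) fd; apply/eigenvalueP; exists (row i P).
    rewrite -row_mul [in LHS]AE !mulmxA mulmxV// mul1mx row_mul.
    by rewrite row_diag_mx -scalemxAl -rowE.
  apply: contraTneq Punit => Pi0; rewrite -row_free_unit.
  apply/negP => /row_freeP[Q] /(congr1 (row i)); rewrite row_mul Pi0 mul0mx.
  by move/rowP/(_ i); rewrite !mxE eqxx => /eqP; rewrite eq_sym oner_eq0.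
have [r rd] := poly_interpolation d (fun x => Num.sqrt (Num.sqrt x)).
pose C := horner_mx A r.
have C4 : (C *m C) *m (C *m C) = A.
  apply: (@map_mx_inj _ _ f); rewrite !mulmxE -!rmorphM.
  rewrite map_horner_mx AE (horner_mx_diagonalizable _ _ Punit).
  suff -> : map_mx (horner (map_poly f (r * r * (r * r)))) sp = sp by [].
  apply/rowP => i; rewrite mxE -fd horner_map !hornerM rd.
  by rewrite -!expr2 !sqr_sqrtr ?sqrtr_ge0.
(* Transposition reverses products, but [A] commutes with every polynomial in [A]. Symmetry then
   makes [C *m C] the Gram matrix [C^T *m C]. *)
have Csym : C^T = C.
  rewrite /C; elim/poly_ind: (r) => [|p c IH].
    by rewrite rmorph0 trmx0.
  rewrite rmorphD rmorphM /= horner_mx_X horner_mx_C linearD/= tr_scalar_mx.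
  by rewrite trmx_mul IH Asym comm_mx_horner.
exists (C *m C); split => //.
by rewrite -{1}Csym; exact: possemidefmx_gram.
Qed.

(** Existence of a root excludes the default case of [xget]. All later arguments know [sqrtmx] only
    through these two properties. *)
Lemma sqrtmxP n (A : 'M[R]_n) : possemidefmx A ->
  possemidefmx (sqrtmx A) /\ sqrtmx A *m sqrtmx A = A.
Proof.
move=> /possemidefmx_sqrt_exists[B BA].
exact: (@xgetPex _ 0 [set B | possemidefmx B /\ B *m B = A] (ex_intro _ B BA)).
Qed.

(** * Invertibility and weighted trace forms *)

Lemma unitmx_inj0 n (A : 'M[R]_n) :
  (forall x : 'cV[R]_n, A *m x = 0 -> x = 0) -> A \in unitmx.
Proof.
(* [kermx] is a left kernel, hence the passage to [A^T]. *)
move=> A0; rewrite -unitmx_tr -row_free_unit -kermx_eq0; apply/eqP/row_matrixP => i.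
rewrite row0; apply: trmx_inj; rewrite trmx0; apply: A0; apply: trmx_inj.
by rewrite trmx_mul trmxK trmx0 -row_mul mulmx_ker row0.
Qed.

Lemma posdefmx_unit n (A : 'M[R]_n) : posdefmx A -> A \in unitmx.
Proof.
move=> [_ Apos]; apply: unitmx_inj0 => x Ax0; apply/eqP.
by apply: contraT => /Apos; rewrite -mulmxA Ax0 mulmx0 mxE ltxx.
Qed.

(** With [B] the square root, the form at [x] is the squared norm of [B *m x]; if it vanishes, so
    does [A *m x = B *m (B *m x)], and then [x]. *)
Lemma possemidefmx_unit_posdefmx n (A : 'M[R]_n) :
  possemidefmx A -> A \in unitmx -> posdefmx A.
Proof.
move=> psdA Au; have [Asym Apos] := psdA; split=> // x x0.
rewrite lt_def Apos andbT; apply: contraNneq x0.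
have [[Bsym _] BB] := sqrtmxP psdA.
rewrite -[in X in X -> _]BB -{1}Bsym gram_form => /mxtrace_mul_tr_eq0 /(congr1 trmx).
rewrite trmxK trmx0 => Bx0.
by rewrite -(mulKmx Au x) -BB -(mulmxA _ _ x) Bx0 !mulmx0.
Qed.

Lemma posdefmx_inv n (A : 'M[R]_n) : posdefmx A -> posdefmx (invmx A).
Proof.
move=> pdA; have Au := posdefmx_unit pdA; have [Asym _] := pdA.
apply: possemidefmx_unit_posdefmx; last by rewrite unitmx_inv.
have := possemidefmx_conj (invmx A) (posdefmx_possemidefmx pdA).
by rewrite mulVmx// mul1mx trmx_inv Asym.
Qed.

(** Exhibits the trace as a squared Frobenius norm, which yields both its sign and, for invertible
    roots, its equality case. *)
Lemma mxtrace_form_gram n m (G : 'M[R]_n) (S : 'M[R]_m) (D : 'M[R]_(n, m)) :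
  possemidefmx G -> possemidefmx S ->
  \tr (G *m D *m S *m D^T)
  = \tr (sqrtmx G *m D *m sqrtmx S *m (sqrtmx G *m D *m sqrtmx S)^T).
Proof.
move=> /sqrtmxP[[gsym _] gg] /sqrtmxP[[ssym _] ss].
rewrite !trmx_mul gsym ssym -[in LHS]gg -[in LHS]ss.
by rewrite -!mulmxA mxtrace_mulC !mulmxA.
Qed.

Lemma mxtrace_form_ge0 n m (G : 'M[R]_n) (S : 'M[R]_m) (D : 'M[R]_(n, m)) :
  possemidefmx G -> possemidefmx S -> 0 <= \tr (G *m D *m S *m D^T).
Proof.
by move=> psdG psdS; rewrite mxtrace_form_gram// mxtrace_mul_tr_ge0.
Qed.

Lemma sqrtmx_unit n (A : 'M[R]_n) : posdefmx A -> sqrtmx A \in unitmx.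
Proof.
move=> pdA; have [_ BB] := sqrtmxP (posdefmx_possemidefmx pdA).
by have := posdefmx_unit pdA; rewrite -[X in X \in _]BB unitmx_mul => /andP[].
Qed.

Lemma mxtrace_form_eq0 n m (G : 'M[R]_n) (S : 'M[R]_m) (D : 'M[R]_(n, m)) :
  posdefmx G -> posdefmx S -> \tr (G *m D *m S *m D^T) = 0 -> D = 0.
Proof.
move=> pdG pdS; rewrite mxtrace_form_gram; try exact: posdefmx_possemidefmx.
move=> /mxtrace_mul_tr_eq0 h.
rewrite -(mulKmx (sqrtmx_unit pdG) D) -(mulmxK (sqrtmx_unit pdS) (_ *m D)).
by rewrite h mul0mx mulmx0.
Qed.

Lemma mxtrace_mul_ge0 n (A B : 'M[R]_n) :
  possemidefmx A -> possemidefmx B -> 0 <= \tr (A *m B).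
Proof.
move=> psdA psdB; have := mxtrace_form_ge0 1%:M psdA psdB.
by rewrite trmx1 !mulmx1.
Qed.

(** * Joint convexity of the matrix fractional function *)

Lemma posdefmx_conv n (A B : 'M[R]_n) (t s : R) :
  posdefmx A -> posdefmx B -> 0 <= t -> 0 <= s -> t + s = 1 ->
  posdefmx (t *: A + s *: B).
Proof.
move=> [As Ap] [Bs Bp] t0 s0 ts; split=> [|x x0].
  by rewrite linearD !linearZ /= As Bs.
rewrite mulmxDr mulmxDl -!scalemxAr -!scalemxAl mxE [X in X + _]mxE [X in _ + X]mxE.
have a0 := Ap x x0; have b0 := Bp x x0.
move: t0 ts; rewrite le_eqVlt => /predU1P[<-|t_gt0] ts.
  by move: ts; rewrite add0r => ->; rewrite mul0r add0r mul1r.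
by rewrite ltr_wpDr ?mulr_ge0 ?mulr_gt0// ltW.
Qed.

(** The gap between the two sides is the form of [invmx A] at [v - A *m u]; it closes when
    [A *m u = v]. *)
Lemma fenchel_young_form n (A : 'M[R]_n) (u v : 'cV[R]_n) : posdefmx A ->
  2 * (u^T *m v) 0 0 - (u^T *m A *m u) 0 0 <= (v^T *m invmx A *m v) 0 0.
Proof.
move=> pdA; have Au := posdefmx_unit pdA; have [Asym _] := pdA.
have [_ /(_ (v - A *m u))] := posdefmx_possemidefmx (posdefmx_inv pdA).
suff -> : ((v - A *m u)^T *m invmx A *m (v - A *m u)) 0 0
    = (v^T *m invmx A *m v) 0 0 - 2 * (u^T *m v) 0 0 + (u^T *m A *m u) 0 0.
  lra.
have vu : (v^T *m u) 0 0 = (u^T *m v) 0 0.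
  by rewrite -[LHS]trace_mx11 -mxtrace_tr trmx_mul trmxK trace_mx11.
rewrite [(v - _)^T]linearB /= trmx_mul Asym !mulmxBl !mulmxBr !mulmxA mulmxK// mulmxKV//.
have sub00 (X Y : 'M[R]_1) : (X - Y) 0 0 = X 0 0 - Y 0 0 by rewrite !mxE.
rewrite !sub00 vu; ring.
Qed.

(** Convexity in the Loewner order, so that it can afterwards be paired with any positive
    semidefinite [S] under the trace. *)
Lemma possemidefmx_fractional_conv n k (A B : 'M[R]_n) (L M : 'M[R]_(n, k)) (t s : R) :
  posdefmx A -> posdefmx B -> 0 <= t -> 0 <= s -> t + s = 1 ->
  possemidefmx (t *: (L^T *m invmx A *m L) + s *: (M^T *m invmx B *m M)
    - (t *: L + s *: M)^T *m invmx (t *: A + s *: B) *m (t *: L + s *: M)).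
Proof.
move=> pdA pdB t0 s0 ts; have pdC := posdefmx_conv pdA pdB t0 s0 ts.
split=> [|w].
  have [As _] := pdA; have [Bs _] := pdB; have [Cs _] := pdC.
  rewrite linearB linearD !linearZ /= !trmx_mul !trmxK !trmx_inv As Bs Cs.
  by rewrite !mulmxA.
set C := t *: A + _ in pdC *; set N := t *: L + _.
have Cu := posdefmx_unit pdC; have [Cs _] := pdC.
(* The maximiser in the Fenchel-Young inequality for C serves as test vector for A and B. *)
pose u := invmx C *m (N *m w).
have := fenchel_young_form u (L *m w) pdA; have := fenchel_young_form u (M *m w) pdB.
(* Equality case for [C]. With [u] fixed, the right side is linear in [(C, N)], so it splits into
   the bounds for [A] and [B] with weights [t] and [s]. *)
have uC : (w^T *m (N^T *m invmx C *m N) *m w) 0 0 =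
    2 * (u^T *m (N *m w)) 0 0 - (u^T *m C *m u) 0 0.
  rewrite /u !trmx_mul trmx_inv Cs !mulmxA mulmxKV//; ring.
rewrite mulmxBr mulmxBl mulmxDr mulmxDl -!scalemxAr -!scalemxAl.
have sub00 (X Y : 'M[R]_1) : (X - Y) 0 0 = X 0 0 - Y 0 0 by rewrite !mxE.
have add00 (X Y : 'M[R]_1) : (X + Y) 0 0 = X 0 0 + Y 0 0 by rewrite !mxE.
have scl00 c (X : 'M[R]_1) : (c *: X) 0 0 = c * X 0 0 by rewrite !mxE.
rewrite sub00 uC /C /N !(mulmxDr, mulmxDl, add00, =^~ scalemxAr, =^~ scalemxAl).
rewrite !scl00 !trmx_mul !mulmxA subr_ge0 => hB hA.
have := lerD (ler_wpM2l t0 hA) (ler_wpM2l s0 hB).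
by apply: le_trans; rewrite le_eqVlt; apply/orP; left; apply/eqP; ring.
Qed.

Lemma mxtrace_fractional_conv n k (A B : 'M[R]_n) (L M : 'M[R]_(n, k))
    (S : 'M[R]_k) (t s : R) :
  posdefmx A -> posdefmx B -> possemidefmx S -> 0 <= t -> 0 <= s -> t + s = 1 ->
  \tr (invmx (t *: A + s *: B) *m (t *: L + s *: M) *m S *m (t *: L + s *: M)^T)
  <= t * \tr (invmx A *m L *m S *m L^T) + s * \tr (invmx B *m M *m S *m M^T).
Proof.
move=> pdA pdB psdS t0 s0 ts.
have trE (C : 'M[R]_n) (N : 'M[R]_(n, k)) :
    \tr (invmx C *m N *m S *m N^T) = \tr (N^T *m invmx C *m N *m S).
  by rewrite mxtrace_mulC !mulmxA.
have := mxtrace_mul_ge0 (possemidefmx_fractional_conv L M pdA pdB t0 s0 ts) psdS.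
rewrite !trE mulmxBl mulmxDl -!scalemxAl linearB linearD !linearZ /=.
by rewrite subr_ge0.
Qed.

(** * Convexity of the objective *)

Lemma objectiveE n m (mx : 'cV[R]_n) (Sx : 'M[R]_n) (Sy : 'M[R]_m)
    (Sxy : 'M[R]_(n, m)) (A : 'M[R]_n) (K : 'M[R]_(n, m)) (bt : 'cV[R]_n) :
  A^T = A ->
  objective mx Sx Sy Sxy (A, K, bt) = 2^-1 * (\tr (A *m Sx)
    + \tr (invmx A *m row_mx 1%:M (- K) *m block_mx Sx Sxy Sxy^T Sy
            *m (row_mx 1%:M (- K))^T)
    + \tr (invmx A *m (bt - mx) *m 1%:M *m (bt - mx)^T)).
Proof.
move=> Asym; rewrite /objective.
(* The weight [1%:M] gives this term the same fractional shape as the term in [K], so the same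
   lemmas treat both. *)
have -> : \tr (invmx A *m (bt - mx) *m 1%:M *m (bt - mx)^T)
    = ((bt - mx)^T *m invmx A *m (bt - mx)) 0 0.
  by rewrite mulmx1 mxtrace_mulC mulmxA trace_mx11.
set z := (_ *m _ *m (bt - mx)) 0 0.
(* Symmetry of [A] merges the two cross terms of the expanded block product into the single one of
   the objective. *)
have K2 : \tr (invmx A *m K *m Sxy^T) = \tr (invmx A *m Sxy *m K^T).
  by rewrite -mxtrace_tr !trmx_mul trmxK trmx_inv Asym mulmxA mxtrace_mulC mulmxA.
rewrite -!(mulmxA (invmx A)) mul_row_block tr_row_mx mul_row_col trmx1 mulmx1 !mul1mx.
rewrite linearN /= mulmxN mulmxDl !mulNmx opprD opprK !mulmxDr !mulmxN !mulmxA.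
rewrite !linearD !linearN /= K2; lra.
Qed.

Lemma convex_set_Theta n m : convex_set (@Theta R n m).
Proof.
move=> p q t; rewrite !inE => pdp pdq.
by apply: posdefmx_conv => //; rewrite ?subr_ge0 ?addrNK// addrC subrK.
Qed.

Lemma convex_objective n m (mx : 'cV[R]_n) (Sx : 'M[R]_n) (Sy : 'M[R]_m)
    (Sxy : 'M[R]_(n, m)) :
  possemidefmx (block_mx Sx Sxy Sxy^T Sy) ->
  convex_function (@Theta R n m) (objective mx Sx Sy Sxy).
Proof.
move=> psdZ t [[A K] b] [[A' K'] b']; rewrite !inE => /= pdA pdA'.
have s0 : 0 <= t%:num by []; have s1 : 0 <= 1 - t%:num by rewrite subr_ge0.
set s := t%:num in s0 s1.
have ss : s + (1 - s) = 1 by rewrite addrC subrK.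
have pdC := posdefmx_conv pdA pdA' s0 s1 ss.
have [As _] := pdA; have [As' _] := pdA'; have [Cs _] := pdC.
change (objective mx Sx Sy Sxy (s *: A + (1 - s) *: A', s *: K + (1 - s) *: K',
    s *: b + (1 - s) *: b') <= s * objective mx Sx Sy Sxy (A, K, b)
    + (1 - s) * objective mx Sx Sy Sxy (A', K', b')).
rewrite !objectiveE//.
(* The block row and [b - mx] are affine in the variables: their constant parts survive because the
   weights add up to 1. *)
have -> : row_mx 1%:M (- (s *: K + (1 - s) *: K'))
    = s *: row_mx 1%:M (- K) + (1 - s) *: row_mx 1%:M (- K').
  rewrite !scale_row_mx add_row_mx; congr row_mx.
    by rewrite -scalerDl ss scale1r.
  by rewrite opprD !scalerN.
have -> : s *: b + (1 - s) *: b' - mx = s *: (b - mx) + (1 - s) *: (b' - mx).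
  rewrite !scalerBr addrACA -opprD -scalerDl ss scale1r //.
have psd1 : possemidefmx (1%:M : 'M[R]_1).
  by have := possemidefmx_gram (1%:M : 'M[R]_1); rewrite trmx1 mulmx1.
have := mxtrace_fractional_conv (row_mx 1%:M (- K)) (row_mx 1%:M (- K'))
  pdA pdA' psdZ s0 s1 ss.
have := mxtrace_fractional_conv (b - mx) (b' - mx) pdA pdA' psd1 s0 s1 ss.
have -> : \tr ((s *: A + (1 - s) *: A') *m Sx)
    = s * \tr (A *m Sx) + (1 - s) * \tr (A' *m Sx).
  by rewrite mulmxDl -!scalemxAl linearD !linearZ.
set b1 := \tr _; set b2 := \tr _; set b3 := \tr _ => hb.
set k1 := \tr _; set k2 := \tr _; set k3 := \tr _ => hk.
rewrite (mulrCA s) (mulrCA (1 - s)) -mulrDr ler_pM2l ?invr_gt0 ?ltr0n//.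
apply: (le_trans (lerD (lerD (lexx _) hk) hb)).
by rewrite le_eqVlt; apply/orP; left; apply/eqP; ring.
Qed.

(** * Minimisation by completing squares *)

Lemma objective_complete_squares n m (mx : 'cV[R]_n) (Sx A0 : 'M[R]_n) (Sy : 'M[R]_m)
    (Sxy : 'M[R]_(n, m)) (A : 'M[R]_n) (K : 'M[R]_(n, m)) (bt : 'cV[R]_n) :
  posdefmx A -> Sy^T = Sy -> Sy \in unitmx -> A0^T = A0 ->
  A0 *m Sx *m A0 = Sx - Sxy *m invmx Sy *m Sxy^T ->
  let K0 := Sxy *m invmx Sy in
  objective mx Sx Sy Sxy (A, K, bt) = \tr (A0 *m Sx) + 2^-1 * (
    \tr (invmx A *m (A - A0) *m Sx *m (A - A0)^T)
    + \tr (invmx A *m (K - K0) *m Sy *m (K - K0)^T)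
    + \tr (invmx A *m (bt - mx) *m 1%:M *m (bt - mx)^T)).
Proof.
move=> pdA Sys Syu A0s A0S K0; have [As _] := pdA; have Au := posdefmx_unit pdA.
rewrite objectiveE//.
(* Completing the square in [K] leaves the Schur complement, which the equation for [A0] replaces by
   [A0 *m Sx *m A0]. *)
have LZL : row_mx 1%:M (- K) *m block_mx Sx Sxy Sxy^T Sy *m (row_mx 1%:M (- K))^T
    = A0 *m Sx *m A0 + (K - K0) *m Sy *m (K - K0)^T.
  have K0Sy : K0 *m Sy = Sxy by rewrite mulmxKV.
  have SyK0 : Sy *m K0^T = Sxy^T by rewrite trmx_mul trmx_inv Sys mulKVmx.
  have K0Sxy : Sxy *m K0^T = Sxy *m invmx Sy *m Sxy^T.
    by rewrite trmx_mul trmx_inv Sys mulmxA.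
  rewrite A0S mul_row_block tr_row_mx mul_row_col trmx1 mulmx1 !mul1mx.
  rewrite [(- K)^T]linearN [(K - K0)^T]linearB /= !mulmxBl !mulmxBr K0Sy.
  rewrite -[K *m Sy *m K0^T]mulmxA SyK0 K0Sxy mulNmx mulmxN mulmxDl !mulNmx.
  move: (Sxy *m invmx Sy *m Sxy^T) (K *m Sxy^T) (Sxy *m K^T) (K *m Sy *m K^T).
  by move=> a b c e; apply/matrixP => i j; rewrite !mxE; ring.
(* In each cross term [A] cancels against [invmx A] under the trace, leaving [\tr (A0 *m Sx)] twice:
   this is the minimal value, once halved. *)
have trA : \tr (invmx A *m (A - A0) *m Sx *m (A - A0)^T)
    = \tr (A *m Sx) - 2 * \tr (A0 *m Sx) + \tr (invmx A *m (A0 *m Sx *m A0)).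
  rewrite [(A - A0)^T]linearB /= As A0s !(mulmxBl, mulmxBr) mulVmx// mul1mx !mulmxA !linearB /=.
  have -> : \tr (invmx A *m A0 *m Sx *m A) = \tr (A0 *m Sx).
    by rewrite mxtrace_mulC !mulmxA mulmxV// mul1mx.
  rewrite (mxtrace_mulC Sx A) (mxtrace_mulC Sx A0); ring.
rewrite trA -!(mulmxA (invmx A)) LZL mulmxDr linearD /= !mulmxA.
lra.
Qed.

Lemma argmin_objective n m (mx : 'cV[R]_n) (Sx A0 : 'M[R]_n) (Sy : 'M[R]_m)
    (Sxy : 'M[R]_(n, m)) :
  posdefmx Sx -> posdefmx Sy -> posdefmx A0 ->
  A0 *m Sx *m A0 = Sx - Sxy *m invmx Sy *m Sxy^T ->
  argmin (@Theta R n m) (objective mx Sx Sy Sxy)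
  = [set (A0, Sxy *m invmx Sy, mx)].
Proof.
move=> pdSx pdSy pdA0 A0S; set K0 := Sxy *m invmx Sy.
have [Sys _] := pdSy; have [A0s _] := pdA0; have Syu := posdefmx_unit pdSy.
have psd1 : posdefmx (1%:M : 'M[R]_1).
  apply: possemidefmx_unit_posdefmx; last exact: unitmx1.
  by have := possemidefmx_gram (1%:M : 'M[R]_1); rewrite trmx1 mulmx1.
have J0 : objective mx Sx Sy Sxy (A0, K0, mx) = \tr (A0 *m Sx).
  rewrite (objective_complete_squares _ _ _ pdA0 Sys Syu A0s A0S) !subrr.
  by rewrite !mulmx0 !mul0mx !linear0 !addr0 mulr0 addr0.
have ge0 k (A : 'M[R]_n) (S : 'M[R]_k) (D : 'M[R]_(n, k)) :
    posdefmx A -> posdefmx S -> 0 <= \tr (invmx A *m D *m S *m D^T).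
  by move=> pdA pdS; apply: mxtrace_form_ge0; apply: posdefmx_possemidefmx => //;
     exact: posdefmx_inv.
apply/seteqP; split=> [[[A K] bt] [pdA /(_ (A0, K0, mx) pdA0)]|_ ->]; last first.
  split=> // -[[A K] bt] pdA.
  rewrite J0 (objective_complete_squares _ _ _ pdA Sys Syu A0s A0S).
  by rewrite lerDl mulr_ge0 ?invr_ge0// !addr_ge0// ge0.
rewrite J0 (objective_complete_squares _ _ _ pdA Sys Syu A0s A0S).
(* Compared with the value at [(A0, K0, mx)], a minimiser makes the sum of these three nonnegative
   terms at most 0, so each one is 0. *)
have h1 := ge0 _ _ _ (A - A0) pdA pdSx.
have h2 := ge0 _ _ _ (K - K0) pdA pdSy.
have h3 := ge0 _ _ _ (bt - mx) pdA psd1 => h.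
have pdAi := posdefmx_inv pdA.
have /(mxtrace_form_eq0 pdAi pdSx)/subr0_eq -> :
    \tr (invmx A *m (A - A0) *m Sx *m (A - A0)^T) = 0 by lra.
have /(mxtrace_form_eq0 pdAi pdSy)/subr0_eq -> :
    \tr (invmx A *m (K - K0) *m Sy *m (K - K0)^T) = 0 by lra.
have /(mxtrace_form_eq0 pdAi psd1)/subr0_eq -> // :
  \tr (invmx A *m (bt - mx) *m 1%:M *m (bt - mx)^T) = 0 by lra.
Qed.

(** With [B = sqrtmx Sx], multiplying [A *m Sx *m A = S] by [B] on both sides says that
    [B *m A *m B] squares to [B *m S *m B]; solving for [A] gives the formula. *)
Lemma posdefmx_riccati n (Sx S : 'M[R]_n) : posdefmx Sx -> posdefmx S ->
  let A := invmx (sqrtmx Sx) *m sqrtmx (sqrtmx Sx *m S *m sqrtmx Sx)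
           *m invmx (sqrtmx Sx) in
  posdefmx A /\ A *m Sx *m A = S.
Proof.
move=> pdSx pdS; have Bu := sqrtmx_unit pdSx.
have [[Bs _] BB] := sqrtmxP (posdefmx_possemidefmx pdSx).
set B := sqrtmx Sx in Bu Bs BB *.
have pdBSB : posdefmx (B *m S *m B).
  apply: possemidefmx_unit_posdefmx; last by rewrite !unitmx_mul Bu posdefmx_unit.
  by have := possemidefmx_conj B (posdefmx_possemidefmx pdS); rewrite Bs.
have Cu := sqrtmx_unit pdBSB.
have [psdC CC] := sqrtmxP (posdefmx_possemidefmx pdBSB).
set C := sqrtmx _ in Cu psdC CC * => A; split.
  apply: possemidefmx_unit_posdefmx; last by rewrite !unitmx_mul !unitmx_inv Bu Cu.
  by have := possemidefmx_conj (invmx B) psdC; rewrite trmx_inv Bs.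
rewrite /A -BB !mulmxA mulmxKV// mulmxK// -[_ *m C *m C]mulmxA CC.
by rewrite !mulmxA mulVmx// mul1mx mulmxK.
Qed.

End PositiveMatrices.

(** * Covariance matrices of square integrable vectors *)

Section Covariance.
Context (R : realType) (d : measure_display) (T : measurableType d)
  (P : probability T R).

Let Pfin : P setT \is a fin_num := fin_num_measure P _ measurableT.

Lemma covariance_fin_num2 (U V : T -> R) :
  U \in Lfun P 2%:E -> V \in Lfun P 2%:E -> covariance P U V \is a fin_num.
Proof.
move=> U2 V2; apply: covariance_fin_num; rewrite ?Lfun2_mul_Lfun1//;
  exact: Lfun_subset12.
Qed.

Lemma Lfun2_sum (I : Type) (s : seq I) (a : I -> R) (F : I -> T -> R) :
  (forall i, F i \in Lfun P 2%:E) ->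
  (fun w => \sum_(i <- s) F i w * a i) \in Lfun P 2%:E.
Proof.
move=> F2; elim: s => [|i s IH].
  by under eq_fun do rewrite big_nil; exact: Lfun_cst.
under eq_fun do rewrite big_cons.
by apply: rpredD; rewrite ?lee1n//= Lfun_scale// ler1n.
Qed.

Lemma fine_covariance_suml (I : Type) (s : seq I) (a : I -> R) (F : I -> T -> R)
    (Z : T -> R) :
  (forall i, F i \in Lfun P 2%:E) -> Z \in Lfun P 2%:E ->
  fine (covariance P (fun w => \sum_(i <- s) F i w * a i) Z)
  = \sum_(i <- s) a i * fine (covariance P (F i) Z).
Proof.
move=> F2 Z2; elim: s => [|i s IH].
  by under eq_fun do rewrite big_nil; rewrite big_nil covariance_cst_l.
under eq_fun do rewrite big_cons.
have aF2 : (a i \o* F i)%R \in Lfun P 2%:E by rewrite Lfun_scale// ler1n.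
(* [fine] is additive on finite values only, hence the square integrability checks on both
   summands. *)
rewrite [X in fine X](covarianceDl aF2)//; last exact: Lfun2_sum.
rewrite fineD; [|exact: covariance_fin_num2|]; last first.
  by apply: covariance_fin_num2 => //; exact: Lfun2_sum.
rewrite IH big_cons; congr (_ + _).
by rewrite covarianceZl ?fineM ?covariance_fin_num2 ?Lfun2_mul_Lfun1 ?Lfun_subset12.
Qed.

(** The quadratic form at [x] is the variance of the combination [Z] of the coordinates with weights
    [x], expanded in one argument and then in the other. *)
Lemma covmx_possemidefmx n (X : T -> 'cV[R]_n) :
  square_integrable P X -> possemidefmx (covmx P X X).
Proof.
move=> X2; split=> [|x]; first by apply/matrixP => i j; rewrite !mxE covarianceC.
pose Z w := \sum_i X w i ord0 * x i 0.
have Z2 : Z \in Lfun P 2%:E by exact: (Lfun2_sum _ (fun i => x i 0) X2).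
suff -> : (x^T *m covmx P X X *m x) 0 0 = fine (covariance P Z Z).
  by rewrite fine_ge0// variance_ge0.
rewrite (fine_covariance_suml _ (fun i => x i 0) X2 Z2) mxE.
apply: eq_bigr => j _; rewrite mulrC; congr (_ * _).
rewrite covarianceC (fine_covariance_suml _ (fun i => x i 0) X2 (X2 j)) mxE.
by apply: eq_bigr => i _; rewrite !mxE.
Qed.

(** Makes the block matrix in the objective a covariance matrix, hence positive semidefinite. *)
Lemma covmx_col_mx n m (X : T -> 'cV[R]_n) (Y : T -> 'cV[R]_m) :
  covmx P (fun w => col_mx (X w) (Y w)) (fun w => col_mx (X w) (Y w))
  = block_mx (covmx P X X) (covmx P X Y) (covmx P X Y)^T (covmx P Y Y).
Proof.
have upE i : (fun w => col_mx (X w) (Y w) (lshift m i) ord0) = fun w => X w i ord0.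
  by apply/funext => w; rewrite col_mxEu.
have downE i : (fun w => col_mx (X w) (Y w) (rshift n i) ord0) = fun w => Y w i ord0.
  by apply/funext => w; rewrite col_mxEd.
apply/matrixP => i j; rewrite [LHS]mxE.
case: (split_ordP i) => i' ->; case: (split_ordP j) => j' ->;
  rewrite ?block_mxEul ?block_mxEur ?block_mxEdl ?block_mxEdr !(upE, downE) !mxE //.
by rewrite covarianceC.
Qed.

Lemma square_integrable_col_mx n m (X : T -> 'cV[R]_n) (Y : T -> 'cV[R]_m) :
  square_integrable P X -> square_integrable P Y ->
  square_integrable P (fun w => col_mx (X w) (Y w)).
Proof.
move=> X2 Y2 i; case: (split_ordP i) => k ->.
  by under eq_fun do rewrite col_mxEu; exact: X2.
by under eq_fun do rewrite col_mxEd; exact: Y2.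
Qed.

End Covariance.

(** * Gradient of the quadratic function *)

Section Gradient.
Variable R : realType.

(** Ensures that [gradient], a mere column of directional derivatives, is a genuine gradient. The
    function is rewritten as a polynomial in the coordinates. *)
Lemma differentiable_quadf n m (A : 'M[R]_n) (K : 'M[R]_(n, m)) (b : 'cV[R]_n)
    (y : 'cV[R]_m) (x : 'cV[R]_n) :
  differentiable ((fun x' => quadf A K b x' y) : 'cV[R]_n -> R^o) x.
Proof.
pose c (i : 'I_n) : 'cV[R]_n -> R := fun x' => x' i 0.
have dc i : differentiable (c i) x by exact: differentiable_coord.
have -> : (fun x' => quadf A K b x' y) = (\sum_(j < n)
    (cst 2^-1 * ((\sum_(i < n) (c i * cst (A i j))) * c j)
     + c j * cst ((K *m y + b) j 0))) :> ('cV[R]_n -> R).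
  apply/funext => x'; rewrite fct_sumE /quadf [in LHS]mxE [X in _ + X]mxE mulr_sumr.
  rewrite -big_split /=; apply: eq_bigr => j _; rewrite mxE [X in _ + X * _]mxE.
  rewrite !fctE; congr (_ * (_ * _) + _).
  by rewrite fct_sumE; apply: eq_bigr => i _; rewrite mxE.
apply: differentiable_sum => j; apply: differentiableD.
  apply: differentiableM; first exact: differentiable_cst.
  apply: differentiableM => //; apply: differentiable_sum => i.
  by apply: differentiableM; last exact: differentiable_cst.
by apply: differentiableM; last exact: differentiable_cst.
Qed.

Lemma derive_quadf n m (A : 'M[R]_n) (K : 'M[R]_(n, m)) (b : 'cV[R]_n)
    (y : 'cV[R]_m) (x v : 'cV[R]_n) : A^T = A ->
  'D_v ((fun x' => quadf A K b x' y) : 'cV[R]_n -> R^o) x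
  = (v^T *m (A *m x + (K *m y + b))) 0 0.
Proof.
move=> As; set l := RHS.
pose q := 2^-1 * (v^T *m A *m v) 0 0.
apply/cvg_lim => //.
(* For nonzero [h] the difference quotient is exactly [l + h * q]; symmetry of [A] merges its two
   cross terms. *)
apply: (@cvg_trans _ ((fun h => l + h * q) @ (0 : R)^')).
  apply: near_eq_cvg; near=> h.
  have h0 : h != 0 by near: h; exact: nbhs_dnbhs_neq.
  have add00 (X Y : 'M[R]_1) : (X + Y) 0 0 = X 0 0 + Y 0 0 by rewrite !mxE.
  have scl00 c (X : 'M[R]_1) : (c *: X) 0 0 = c * X 0 0 by rewrite !mxE.
  have xv : (x^T *m A *m v) 0 0 = (v^T *m A *m x) 0 0.
    by rewrite -[LHS]trace_mx11 -mxtrace_tr !trmx_mul trmxK As mulmxA trace_mx11.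
  have tr_hvx : (h *: v + x)^T = h *: v^T + x^T by rewrite linearD linearZ.
  rewrite /l /q /quadf /= tr_hvx !(mulmxDl, mulmxDr, =^~ scalemxAl,
    =^~ scalemxAr, add00, scl00) !mulmxA xv.
  rewrite /GRing.scale /=; field; exact: h0.
have : (fun h => l + h * q) @ (0 : R) --> l + 0 * q.
  apply: cvgD; first exact: cvg_cst.
  apply: cvgM; [exact: cvg_id|exact: cvg_cst].
rewrite mul0r addr0 => lq; exact: cvg_within_filter lq.
Unshelve. all: by end_near.
Qed.

Lemma gradient_quadf n m (A : 'M[R]_n) (K : 'M[R]_(n, m)) (b : 'cV[R]_n)
    (y : 'cV[R]_m) (x : 'cV[R]_n) : A^T = A ->
  gradient (fun x' => quadf A K b x' y) x = A *m x + (K *m y + b).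
Proof.
move=> As; apply/colP => i.
by rewrite mxE derive_quadf// trmx_delta -rowE mxE.
Qed.

End Gradient.

(** Invertibility of [Sy] gives meaning to the inverse in the formulas, and positive definiteness of
    the Schur complement puts [A] in [Theta]. Equality of [argmin] with a singleton is existence and
    uniqueness at once. *)
Theorem proposition1 (R : realType) (d : measure_display)
    (T : measurableType d) (P : probability T R) (n m : nat)
    (X : T -> 'cV[R]_n) (Y : T -> 'cV[R]_m)
    (hX : square_integrable P X) (hY : square_integrable P Y)
    (hSx : posdefmx (covmx P X X)) :
  let mx := meanv P X in
  let my := meanv P Y in
  let Sx := covmx P X X in
  let Sy := covmx P Y Y in
  let Sxy := covmx P X Y in
  let J := objective mx Sx Sy Sxy in
  convex_set (@Theta R n m) /\
  convex_function (@Theta R n m) J /\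
  (Sy \in unitmx -> posdefmx (Sx - Sxy *m invmx Sy *m Sxy^T) ->
    let bt := mx in
    let K := Sxy *m invmx Sy in
    let Sx12 := sqrtmx Sx in
    let A := invmx Sx12
             *m sqrtmx (Sx12 *m (Sx - Sxy *m invmx Sy *m Sxy^T) *m Sx12)
             *m invmx Sx12 in
    let b := bt - A *m mx - K *m my in
    argmin (@Theta R n m) J = [set (A, K, bt)] /\
    forall (x : 'cV[R]_n) (y : 'cV[R]_m),
      differentiable ((fun x' => quadf A K b x' y) : 'cV[R]_n -> R^o) x /\
      gradient (fun x' => quadf A K b x' y) x
        = mx + A *m (x - mx) + K *m (y - my)).
Proof.
move=> mx my Sx Sy Sxy J.
split; first exact: convex_set_Theta.
split.
  apply: convex_objective; rewrite /Sxy -covmx_col_mx.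
  exact: covmx_possemidefmx (square_integrable_col_mx hX hY).
move=> Syu pdS bt K Sx12 A b.
have [pdA A0S] := posdefmx_riccati hSx pdS.
(* Uniqueness of [K] rests on [Sy] being definite: a covariance matrix is semidefinite, and this one
   is invertible. *)
have pdSy := possemidefmx_unit_posdefmx (covmx_possemidefmx hY) Syu.
split; first exact: argmin_objective.
move=> x y; split; first exact: differentiable_quadf.
have [As _] := pdA.
rewrite gradient_quadf// /b /bt !mulmxBr.
move: (A *m x) (K *m y) (K *m my) (A *m mx) => u v w z.
by apply/matrixP => i j; rewrite !mxE; ring.
Qed.
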